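(* Let $p,q\ge 3$ and $n\ge p+q-1$ be integers. Let $G\in \mathscr{B}_n^{p,q}$ with $G\neq S_n^{p,q}$ (up to isomorphism). Then $D_R(G)>D_R(S_n^{p,q})$.
   Context: All graphs are finite, simple and connected. For vertices $u,v$ of a graph $G$, the resistance distance $r(u,v)$ is the effective resistance between $u$ and $v$ in the electrical network obtained from $G$ by replacing every edge by a unit resistor. The degree resistance distance of $G$ is $D_R(G)=\sum_{\{u,v\}\subseteq V(G)}[d(u)+d(v)]\,r(u,v)$, where $d(u)$ is the degree of $u$ and the sum runs over unordered pairs of distinct vertices. A bicyclic graph is a connected graph with $|E(G)|=|V(G)|+1$. $\mathscr{B}_n^{p,q}$ denotes the set of $n$-vertex bicyclic graphs having exactly two cycles, of lengths $p$ and $q$; equivalently, graphs consisting of two cycles $C_p=v_1v_2\cdots v_pv_1$ and $C_q=u_1u_2\cdots u_qu_1$ joined by a path $v_1w_1\cdots w_{m-1}u_1$ of length $m\ge 0$ (when $m=0$, $v_1=u_1$ and the cycles share exactly this vertex), together with trees rooted at each vertex of the cycles and of the path. $S_n^{p,q}$ is the graph obtained from cycles $C_p$ and $C_q$ sharing exactly one common vertex by attaching $n+1-p-q$ pendent edges to that common vertex. *)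

(* Defs.v *)
From HB Require Import structures.
From mathcomp Require Import all_boot all_order all_algebra.

Set Implicit Arguments.
Unset Strict Implicit.
Unset Printing Implicit Defensive.

Import Order.TTheory GRing.Theory Num.Theory.
Local Open Scope ring_scope.

Section Graphs.
Context (T : finType).
Implicit Type e : rel T.

Definition simple_graph e := symmetric e /\ irreflexive e.

Definition connected_graph e := forall x y : T, connect e x y.

Definition edges e : {set {set T}} :=
  [set [set z.1; z.2] | z : T * T & e z.1 z.2].

Definition degree e (x : T) : nat := #|[set y | e x y]|.

Definition cycle_edges (c : seq T) : {set {set T}} :=
  [set [set x; next c x] | x in c].

(* Cycles are subgraphs, represented by their edge sets: the vertex sequences
   that differ by a rotation or a reversal give the same [C], and the length
   of the cycle is #|C|. *)
Definition is_cycle e (C : {set {set T}}) : Prop :=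
  exists c : seq T, [/\ ucycle e c, (2 < size c)%N & C = cycle_edges c].

Definition bicyclic e :=
  [/\ simple_graph e, connected_graph e & #|edges e| = #|T|.+1].

Definition exactly_two_cycles (p q : nat) e :=
  exists C1 C2 : {set {set T}},
    [/\ C1 <> C2, #|C1| = p, #|C2| = q
      & forall C, is_cycle e C <-> C = C1 \/ C = C2].

Definition bicyclic_class (n p q : nat) e :=
  [/\ #|T| = n, bicyclic e & exactly_two_cycles p q e].

End Graphs.

Definition graph_iso (T T' : finType) (e : rel T) (e' : rel T') : Prop :=
  exists f : T -> T', bijective f /\ forall x y, e' (f x) (f y) = e x y.

Section Resistance.
Context (R : realFieldType) (T : finType) (e : rel T).
Implicit Types (u v x y : T) (phi : {ffun T -> R^o}).

(* Net current leaving each vertex, under the potential phi, when every edge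
   is a unit resistor. *)
Definition laplacian phi : {ffun T -> R^o} :=
  [ffun x => \sum_(y | e x y) (phi x - phi y)].

Fact laplacian_is_linear : linear laplacian.
Proof.
move=> a f g; apply/ffunP=> x; rewrite !ffunE scaler_sumr -big_split /=.
apply: eq_bigr => y _; rewrite !ffunE scalerBr opprD addrACA; congr (_ + _).
Qed.

HB.instance Definition _ := GRing.isLinear.Build R {ffun T -> R^o}
  {ffun T -> R^o} *:%R laplacian laplacian_is_linear.

Definition unit_flow u v : {ffun T -> R^o} :=
  [ffun x => (x == u)%:R - (x == v)%:R].

(* [(linfun laplacian)^-1] inverts the Laplacian on its image, so this solves
   Kirchhoff's equation [laplacian phi = unit_flow u v] on a connected graph
   (lemma [potentialP]). *)
Definition potential u v : {ffun T -> R^o} :=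
  ((linfun laplacian)^-1)%VF (unit_flow u v).

Definition resistance u v : R := potential u v u - potential u v v.

(* Comparing the ranks selects each unordered pair of distinct vertices once;
   the order is irrelevant by [resistanceC]. *)
Definition degree_resistance_distance : R :=
  \sum_(u : T) \sum_(v : T | (enum_rank u < enum_rank v)%N)
    (degree e u + degree e v)%:R * resistance u v.

Lemma resistanceC u v : resistance u v = resistance v u.
Proof.
rewrite /resistance /potential.
have -> : unit_flow v u = - unit_flow u v.
  by apply/ffunP => x; rewrite !ffunE opprB.
by rewrite linearN !ffunE opprK addrC.
Qed.

Context (e_simple : simple_graph e) (e_conn : connected_graph e).

Lemma laplacian_sum phi : \sum_x laplacian phi x = 0.
Proof.
under eq_bigr do rewrite ffunE big_mkcond /=.
set F := fun x y => if e x y then phi x - phi y else 0.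
suff: \sum_x \sum_y F x y = - \sum_x \sum_y F x y.
  by move/eqP; rewrite -addr_eq0 -mulr2n mulrn_eq0 => /eqP.
rewrite {1}exchange_big /= -sumrN; apply: eq_bigr => x _.
rewrite -sumrN; apply: eq_bigr => y _.
by rewrite /F e_simple.1; case: ifP => _; rewrite ?oppr0 ?opprB.
Qed.

Lemma laplacian_ker phi : laplacian phi = 0 -> forall x y, phi x = phi y.
Proof.
move=> L0 x0.
pose m := [arg max_(i > x0) phi i]%O.
have max_m y : phi y <= phi m by rewrite /m; case: arg_maxP => // i _; apply.
suff eq_m y : phi y = phi m by move=> y; rewrite !eq_m.
have step a b : e a b -> phi a = phi m -> phi b = phi m.
  move=> eab am; move/ffunP/(_ a): L0; rewrite !ffunE => /eqP.
  rewrite psumr_eq0 => [|z _]; last by rewrite subr_ge0 am.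
  move/allP/(_ b (mem_index_enum _)); rewrite eab subr_eq0 => /eqP <-.
  by [].
have /connectP[s + ->] := e_conn m y.
move: (erefl (phi m)); move: {1 3 4}m.
elim: s => //= b s IHs a am /andP[eab]; apply: IHs; exact: step am.
Qed.

Lemma potentialP u v : laplacian (potential u v) = unit_flow u v.
Proof.
pose L : 'End({ffun T -> R^o}) := linfun laplacian.
pose k : {ffun T -> R^o} := [ffun=> 1].
have sum_k (c : R) : \sum_x (c *: k) x = 0 -> c = 0.
  under eq_bigr do rewrite !ffunE [_ *: _]mulr1.
  rewrite sumr_const => /eqP; rewrite mulrn_eq0.
  by case/orP=> /eqP // T0; have := fintype0 u T0.
have kerL : (lker L <= <[k]>)%VS.
  apply/subvP=> f; rewrite memv_ker lfunE => /eqP/laplacian_ker f_const.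
  apply/vlineP; exists (f u); apply/ffunP=> x.
  by rewrite !ffunE (f_const x u) [_ *: _]mulr1.
have capLk : (limg L :&: <[k]> = 0)%VS.
  apply/eqP; rewrite -subv0; apply/subvP=> f; rewrite memv_cap.
  case/andP=> /memv_imgP[g _ ->] /vlineP[c Lg].
  rewrite Lg (sum_k c) ?scale0r ?mem0v // -Lg lfunE; exact: laplacian_sum.
have fullLk : (limg L + <[k]>)%VS = fullv.
  apply/eqP; rewrite eqEdim subvf -(limg_ker_dim L fullv) capfv.
  by rewrite dimv_disjoint_sum // addnC leq_add2l dimvS.
have := memvf (unit_flow u v); rewrite -fullLk => /memv_addP[f Lf].
case=> _ /vlineP[c ->] uv.
suff c0 : c = 0.
  have := limg_lfunVK Lf; rewrite lfunE /= /potential uv c0 scale0r addr0.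
  by [].
apply: sum_k; have/memv_imgP[g _ fE] := Lf.
have -> : c *: k = unit_flow u v - f by rewrite uv addrC addKr.
under eq_bigr do rewrite !ffunE; rewrite !sumrB.
rewrite [X in _ - X](_ : _ = 0) ?subr0; last first.
  rewrite -[RHS](laplacian_sum g); apply: eq_bigr => x _.
  by rewrite fE lfunE.
have sum1 a : \sum_(x : T) (x == a)%:R = 1 :> R.
  by rewrite (bigD1 a) //= eqxx big1 ?addr0 // => x /negPf->.
by rewrite !sum1 subrr.
Qed.

Lemma resistance_potential phi u v :
  laplacian phi = unit_flow u v -> resistance u v = phi u - phi v.
Proof.
move=> Lphi; have /laplacian_ker/(_ u v) : laplacian (potential u v - phi) = 0.
  by rewrite linearB /= Lphi potentialP subrr.
rewrite /resistance !ffunE => /eqP; rewrite subr_eq => /eqP->.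
by rewrite addrC !addrA addNr add0r addrC.
Qed.

End Resistance.

(* The common vertex is 0, the cycles are 0, 1, ..., p - 1 and
   0, p, ..., p + q - 2, and the pendent vertices are p + q - 1, ..., n - 1. *)
Definition cycle_adj (c : seq nat) : rel nat :=
  fun x y => [&& x \in c, y \in c & (y == next c x) || (x == next c y)].

Definition pendent_adj (p q : nat) : rel nat :=
  fun x y => (x == 0%N) && (p + q - 1 <= y)%N.

Definition S_graph (n p q : nat) : rel 'I_n :=
  fun x y => [|| cycle_adj (iota 0 p) x y,
                 cycle_adj (0%N :: iota p q.-1) x y,
                 pendent_adj p q x y | pendent_adj p q y x].
Arguments S_graph : clear implicits.

(* Main.v *)
(* A graph with exactly two cycles, these being edge-disjoint, is a cactus, and
   its resistance distance is the sum over the blocks (the two cycles and the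
   bridges) of the resistance, inside the block, between the projections of the
   two vertices.  A cycle of length k contributes d (k - d) / k for projections
   at distance d along the cycle, and a bridge twice the value of this formula
   for k = 2, so that cycles and bridges need not be distinguished.

   Let t(x) be the resistance curvature, so that the Laplacian of r(., v) at x
   is t(x) - 2 [x = v].  Then the degree of x is 2 - t(x) + sum 2/|C|, where C
   ranges over the cycles through x, and sum_x t(x) r(x, v) depends only on the
   block lengths.  Hence D_R(G) splits into a constant that depends only on n
   and the block lengths and, for each block B, nonnegative terms r_B(x, v)
   with v outside B and x outside B or on a cycle other than B.  All these terms
   vanish iff each block has a single vertex to which the rest of the graph is
   attached and, as there are two cycles, this vertex is the same for all
   blocks, which characterises S_n^{p,q}. *)

Require Import Defs.
From mathcomp Require Import all_boot all_order all_algebra.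
From mathcomp Require Import ring lra zify.
Import Order.TTheory GRing.Theory Num.Theory.
Local Open Scope ring_scope.

Set Implicit Arguments.
Unset Strict Implicit.
Unset Printing Implicit Defensive.

(** * Neighbours on a cyclic sequence *)

Section CyclicSequences.
Context (T : eqType).
Implicit Types (c : seq T) (x y : T).

(** On a sequence of two elements this is a single edge, so that a bridge can be treated as a cycle
    of length 2. *)
Definition neighbours c : rel T :=
  fun x y => [&& x \in c, y \in c & (y == next c x) || (x == next c y)].

Lemma neighbours_sym c : symmetric (neighbours c).
Proof. by move=> x y; rewrite /neighbours andbCA orbC. Qed.

Lemma index_next c x : uniq c -> x \in c ->
  index (next c x) c =
    if ((index x c).+1 < size c)%N then (index x c).+1 else 0%N.
Proof.
case: c => // a s Us xs; rewrite next_nth xs.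
have: (index x (a :: s) < size (a :: s))%N by rewrite index_mem.
set i := index x _ => lti; rewrite /= ltnS in lti *.
(* At the last position [nth] returns its default, the head [a], whose index is 0. *)
case: ltnP => [lt_i | ge_i]; last by rewrite nth_default // eqxx.
by rewrite -[nth a s i]/(nth a (a :: s) i.+1) -[RHS](index_uniq a _ Us).
Qed.

Lemma index_prev c x : uniq c -> x \in c ->
  index (prev c x) c = if index x c == 0%N then (size c).-1 else (index x c).-1.
Proof.
move=> Uc xc; have yc : prev c x \in c by rewrite mem_prev.
have := index_next Uc yc; rewrite next_prev // => ->.
by move: yc; rewrite -index_mem; case: (ltnP _.+1 _) => //=; lia.
Qed.

Lemma next_prev_neq c x : uniq c -> (2 < size c)%N -> x \in c ->
  next c x != prev c x.
Proof.
move=> Uc kc xc; apply/eqP=> /(congr1 (index^~ c)).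
rewrite index_next // index_prev //; move: (xc); rewrite -index_mem.
by case: (ltnP _.+1 _); case: eqP; lia.
Qed.

Lemma next_neq c x : uniq c -> (1 < size c)%N -> x \in c -> next c x != x.
Proof.
move=> Uc kc xc; apply/eqP=> /(congr1 (index^~ c)).
rewrite index_next //; move: (xc); rewrite -index_mem.
by case: (ltnP _.+1 _); lia.
Qed.

Lemma neighbours_neq c x y :
  uniq c -> (1 < size c)%N -> neighbours c x y -> x != y.
Proof.
move=> Uc kc /and3P[xc yc /orP[/eqP-> | /eqP->]]; last exact: next_neq.
by rewrite eq_sym next_neq.
Qed.

Lemma neighboursE c x y : uniq c -> x \in c ->
  neighbours c x y = (y == next c x) || (y == prev c x).
Proof.
move=> Uc xc; rewrite /neighbours xc /=.
case: (y =P next c x) => [->|_] /=; first by rewrite mem_next xc.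
apply/andP/eqP=> [[yc /eqP->] | ->]; first by rewrite prev_next.
by rewrite mem_prev xc next_prev.
Qed.

End CyclicSequences.

(** On a cycle of length 2 the successor and the predecessor are the same neighbour; the factor 2
    restores the double count. *)
Lemma big_neighbours (R : nzRingType) (T : finType) (c : seq T) (F : T -> R) x :
  uniq c -> (1 < size c)%N -> x \in c ->
  (if size c == 2 then 2%:R else 1) * \sum_(y | neighbours c x y) F y =
    F (next c x) + F (prev c x).
Proof.
move=> Uc kc xc; under eq_bigl => y do rewrite neighboursE //.
case: eqP => [k2 | /eqP kn2].
  have -> : prev c x = next c x.
    have idx := mem_next c x; rewrite xc in idx.
    have idy := mem_prev c x; rewrite xc in idy.
    rewrite -[LHS](nth_index x idy) -[RHS](nth_index x idx); congr nth.
    move: (xc); rewrite -index_mem index_next // index_prev // k2.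
    by case: (index x c) => [|[]].
  under eq_bigl => y do rewrite orbb.
  by rewrite big_pred1_eq mulr_natl mulr2n.
have kgt2 : (2 < size c)%N by rewrite ltn_neqAle eq_sym kn2.
have neq := next_prev_neq Uc kgt2 xc.
rewrite mul1r (bigD1 (next c x)) ?eqxx //= (bigD1 (prev c x)) /=; last first.
  by rewrite eqxx orbT eq_sym.
by rewrite big1 ?addr0 // => y /andP[/andP[/orP[]/eqP-> ]]; rewrite eqxx.
Qed.

(** * Resistance within a single cycle *)

Section CycleResistance.
Context (R : realFieldType).
Implicit Types k i j : nat.

(** The two arcs between positions [i] and [j] are [d] and [k - d] unit resistors in series,
    connected in parallel. *)
Definition cycle_resistance k i j : R :=
  let d := `|i%:R - j%:R| in d * (k%:R - d) / k%:R.

Lemma cycle_resistanceC k i j : cycle_resistance k i j = cycle_resistance k j i.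
Proof. by rewrite /cycle_resistance distrC. Qed.

Lemma cycle_resistance0 k i : cycle_resistance k i i = 0.
Proof. by rewrite /cycle_resistance subrr normr0 !mul0r. Qed.

Lemma cycle_resistance_gt0 k i j :
  (i < k)%N -> (j < k)%N -> i != j -> 0 < cycle_resistance k i j.
Proof.
move=> ik jk ij; rewrite /cycle_resistance.
have k0 : 0 < k%:R :> R by rewrite ltr0n; lia.
have [ik' jk'] : i%:R < k%:R :> R /\ j%:R < k%:R :> R by rewrite !ltr_nat.
have i0 := ler0n R i; have j0 := ler0n R j.
rewrite divr_gt0 // mulr_gt0 ?normr_gt0 ?subr_eq0 ?eqr_nat //.
by rewrite subr_gt0 ltr_norml; lra.
Qed.

Lemma cycle_resistance_le k i j : (j <= i)%N ->
  cycle_resistance k i j = (i%:R - j%:R) * (k%:R - (i%:R - j%:R)) / k%:R.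
Proof.
by move=> ji; rewrite /cycle_resistance ger0_norm // subr_ge0 ler_nat.
Qed.

(** Positions 0 and [k] name the same vertex, so the successor of [k - 1] can be taken to be [k]. *)
Lemma cycle_resistance_wrap k j : (0 < k)%N -> (j < k)%N ->
  cycle_resistance k 0 j = cycle_resistance k k j.
Proof.
move=> k0 jk; rewrite cycle_resistanceC !cycle_resistance_le //; last exact: ltnW.
by congr (_ / _); ring.
Qed.

(** The quadratic [d - d ^ 2 / k] has constant second difference [- 2 / k]; the corner of the
    absolute value at [d = 0] accounts for the extra 2. *)
Lemma cycle_resistance_laplacian k i j : (1 < k)%N -> (i < k)%N -> (j < k)%N ->
  let f := cycle_resistance k in
  (f i j - f (if (i.+1 < k)%N then i.+1 else 0%N) j) +
  (f i j - f (if i == 0%N then k.-1 else i.-1) j) =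
  2%:R / k%:R - 2%:R *+ (i == j).
Proof.
move=> k1 ik jk f.
have k0 : k%:R != 0 :> R by rewrite pnatr_eq0; lia.
have -> : f (if (i.+1 < k)%N then i.+1 else 0%N) j = f i.+1 j.
  case: ltnP => // ki; have -> : i.+1 = k by lia.
  by rewrite /f cycle_resistance_wrap //; lia.
have [-> | i0] := eqVneq i 0%N.
  rewrite /f; have [-> | j0] := eqVneq j 0%N.
    rewrite !cycle_resistance_le //= -subn1 natrB; last by lia.
    by field.
  rewrite 3![cycle_resistance _ _ j]cycle_resistanceC.
  rewrite (cycle_resistanceC _ j k.-1) !cycle_resistance_le //; try lia.
  by rewrite -subn1 natrB; [rewrite [_ *+ nat_of_bool _]mulr0n; field | lia].
case: i i0 ik => // i _ ik; rewrite /f /=.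
case: (ltngtP i.+1 j) => ij.
- rewrite 3![cycle_resistance _ _ j]cycle_resistanceC.
  rewrite !cycle_resistance_le //; try lia.
  by rewrite [_ *+ nat_of_bool _]mulr0n -!natr1; field.
- rewrite !cycle_resistance_le //; try lia.
  by rewrite [_ *+ nat_of_bool _]mulr0n -!natr1; field.
- rewrite -ij (cycle_resistanceC _ i i.+1) !cycle_resistance_le //; try lia.
  by rewrite [_ *+ nat_of_bool _]mulr1n -!natr1; field.
Qed.

Definition cycle_transmission k : R := \sum_(i < k) cycle_resistance k i 0.

(** Shifting both positions by one matches all terms but one: the last position seen from [j] and
    position 0 seen from [j + 1] are at complementary distances, which have the same resistance. *)
Lemma cycle_transmissionE k j : (j < k)%N ->
  \sum_(i < k) cycle_resistance k i j = cycle_transmission k.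
Proof.
case: k => // k; elim: j => // j IHj jk.
have {IHj}<- := IHj (ltnW jk).
rewrite [LHS]big_ord_recl [RHS]big_ord_recr /= addrC; congr (_ + _).
  rewrite cycle_resistanceC !cycle_resistance_le //; last exact: ltnW.
  by congr (_ / _); rewrite -natr1; ring.
apply: eq_bigr => i _.
by rewrite /cycle_resistance /bump add1n -!natr1 opprD addrACA subrr addr0.
Qed.

End CycleResistance.

(** * Resistance in a cactus *)

(* Block [i] is the cycle [c i], a bridge being a "cycle" of length 2, and
   [lab i x] is the vertex of block [i] which is nearest to [x]. *)
Record cactus (T I : finType) (e : rel T) (c : I -> seq T)
    (lab : I -> T -> T) : Prop := Cactus {
  cactus_sym : symmetric e;
  cactus_connected : connected_graph e;
  block_uniq : forall i, uniq (c i);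
  block_size : forall i, (1 < size (c i))%N;
  lab_mem : forall i x, lab i x \in c i;
  lab_id : forall i x, x \in c i -> lab i x = x;
  lab_neighbours : forall i x y,
    e x y -> lab i x != lab i y -> neighbours (c i) x y;
  neighbours_edge : forall i x y, neighbours (c i) x y -> e x y;
  edge_block : forall x y, e x y ->
    exists i, forall j, (lab j x != lab j y) = (j == i) }.

Section Cactus.
Context (T I : finType) (e : rel T) (c : I -> seq T) (lab : I -> T -> T).
Hypothesis G : cactus e c lab.
Implicit Types (x y v : T) (i j : I).

Let Uc i : uniq (c i) := block_uniq G i.
Let kc i : (1 < size (c i))%N := block_size G i.
Let cL i x : lab i x \in c i := lab_mem G i x.

Lemma cactus_irr : irreflexive e.
Proof.
move=> x; apply/negP=> /(edge_block G)[i /(_ i)].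
by rewrite !eqxx.
Qed.

Lemma cactus_simple : simple_graph e.
Proof. by split; [apply: cactus_sym G | apply: cactus_irr]. Qed.

Lemma block_edgeE i x y : e x y && (lab i x != lab i y) = neighbours (c i) x y.
Proof.
apply/andP/idP=> [[]|nxy]; first exact: (lab_neighbours G).
have [xc yc _] := and3P nxy.
by rewrite !(lab_id G) // (neighbours_edge G nxy) (neighbours_neq _ _ nxy).
Qed.

(** Each edge changes the projection on exactly one block, so a walk along block [j] never changes
    the projection on block [i]. *)
Lemma lab_const i j x y : i != j -> x \in c j -> y \in c j -> lab i x = lab i y.
Proof.
move=> ij; have step z : z \in c j -> lab i (next (c j) z) = lab i z.
  move=> zc; have nz : neighbours (c j) z (next (c j) z).
    by rewrite /neighbours zc mem_next zc eqxx.
  have /andP[ez] := etrans (block_edgeE j z (next (c j) z)) nz.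
  have [l lP] := edge_block G ez; rewrite lP => /eqP jl.
  by apply/eqP; rewrite eq_sym; apply/negPn; rewrite lP -jl ij.
suff all_head z : z \in c j -> lab i z = lab i (head z (c j)).
  move=> xc yc; rewrite (all_head x) // (all_head y) //.
  by case: (c j) xc.
move=> zc; rewrite -[in LHS](nth_index z zc).
have := zc; rewrite -index_mem; elim: (index z (c j)) => [|m IHm] mk.
  by rewrite nth0.
rewrite -(IHm (ltnW mk)).
have yc : nth z (c j) m \in c j by rewrite mem_nth // ltnW.
rewrite -[RHS]step //; congr (lab i _).
have zn : next (c j) (nth z (c j) m) \in c j by rewrite mem_next.
rewrite -[RHS](nth_index z zn); congr nth.
by rewrite index_next // index_uniq ?(ltnW mk) // mk.
Qed.

(* On a path that leaves [x] for good, only the first edge can separate [x]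
   from the end of the path. *)
Lemma separating_block x v : x != v ->
  exists2 i, x \in c i & forall j, x \in c j -> (lab j v != x) = (j == i).
Proof.
move=> xv; have /connectP[s0] := cactus_connected G x v.
case/shortenP=> [[|y s]]; first by move=> _ _ _ vx; rewrite vx eqxx in xv.
case/andP=> exy ps /andP[xs _] _ -> {s0 v xv}.
have [i iP] := edge_block G exy.
have nxy : neighbours (c i) x y by rewrite -block_edgeE exy iP eqxx.
have [xi _ _] := and3P nxy; exists i => // j xj.
rewrite -iP (lab_id G xj) (eq_sym x); congr (~~ _).
elim: s y ps xs {exy iP nxy} => //= z s IHs y /andP[eyz ps].
rewrite !inE !negb_or => /and3P[xy xz xs].
rewrite IHs // ?inE ?negb_or ?xz //.
have [-> // | nyz] := eqVneq (lab j y) (lab j z).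
have /and3P[yc zc _] := lab_neighbours G eyz nyz.
by rewrite !(lab_id G) // !(eq_sym _ x) (negbTE xy) (negbTE xz).
Qed.

Section Resistance.
Context (R : realFieldType).

Definition block_weight i : R := if size (c i) == 2 then 2%:R else 1.

(* The factor compensates that a bridge is one unit resistor, and not two
   parallel ones. *)
Definition block_resistance i x y : R :=
  block_weight i * cycle_resistance R (size (c i))
                     (index (lab i x) (c i)) (index (lab i y) (c i)).

Local Notation r := block_resistance.

Lemma block_weight_gt0 i : 0 < block_weight i.
Proof. by rewrite /block_weight; case: ifP => _; rewrite ?ltr0n ?ltr01. Qed.

Lemma block_resistanceC i x y : r i x y = r i y x.
Proof. by rewrite /r cycle_resistanceC. Qed.

Lemma eq_block_resistance i x x' y : lab i x = lab i x' -> r i x y = r i x' y.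
Proof. by rewrite /r => ->. Qed.

Lemma block_resistance0 i x y : lab i x = lab i y -> r i x y = 0.
Proof. by rewrite /r => ->; rewrite cycle_resistance0 mulr0. Qed.

Lemma block_resistance_gt0 i x y : lab i x != lab i y -> 0 < r i x y.
Proof.
move=> nxy; rewrite mulr_gt0 ?block_weight_gt0 // cycle_resistance_gt0 ?index_mem //.
by apply: contra nxy => /eqP/(index_inj x (cL i x) (cL i y)) ->.
Qed.

Lemma block_resistance_ge0 i x y : 0 <= r i x y.
Proof.
have [/block_resistance0-> // | /block_resistance_gt0/ltW //] :=
  eqVneq (lab i x) (lab i y).
Qed.

(** Edges outside block [i] do not change the projection and contribute nothing; the edges inside
    give the Laplacian of a cycle. *)
Lemma block_laplacian i x v :
  \sum_(y | e x y) (r i x v - r i y v) =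
  if x \in c i then 2%:R / (size (c i))%:R - 2%:R *+ (lab i v == x) else 0.
Proof.
transitivity (\sum_(y | neighbours (c i) x y) (r i x v - r i y v)).
  rewrite big_mkcond [RHS]big_mkcond /=; apply: eq_bigr => y _.
  rewrite -block_edgeE; case: (e x y) => //=.
  by case: eqP => //= /eq_block_resistance->; rewrite subrr.
case: ifP => xc; last by rewrite big1 // => y; rewrite /neighbours xc.
set k := size (c i).
pose f y := cycle_resistance R k (index y (c i)) (index (lab i v) (c i)).
transitivity (block_weight i * \sum_(y | neighbours (c i) x y) (f x - f y)).
  rewrite mulr_sumr; apply: eq_bigr => y /and3P[_ yc _].
  by rewrite /r (lab_id G xc) (lab_id G yc) mulrBr.
rewrite big_neighbours // /f index_next // index_prev //.
have -> : (lab i v == x) = (index x (c i) == index (lab i v) (c i)).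
  by apply/eqP/eqP=> [->|/(index_inj x xc (cL i v))].
by apply: cycle_resistance_laplacian; rewrite /k ?index_mem.
Qed.

Definition cactus_resistance x y := \sum_i r i x y.
Local Notation rr := cactus_resistance.

Lemma cactus_resistanceC x y : rr x y = rr y x.
Proof. by apply: eq_bigr => i _; rewrite block_resistanceC. Qed.

Lemma cactus_resistance0 x : rr x x = 0.
Proof. by apply: big1 => i _; rewrite block_resistance0. Qed.

(* The resistance curvature: up to the term [- 2 [x = v]], the Laplacian of
   [cactus_resistance _ v] does not depend on [v]. *)
Definition curvature x : R :=
  2%:R + \sum_(i | x \in c i) (2%:R / (size (c i))%:R - 2%:R).

(** Block Laplacians at [x] subtract 2 for each block through [x] in which [v] projects to [x].
    These are all blocks through [x] if [x = v], and all but one otherwise, by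
    [separating_block]. *)
Lemma laplacian_cactus_resistance x v :
  \sum_(y | e x y) (rr x v - rr y v) = curvature x - 2%:R *+ (x == v).
Proof.
under eq_bigr do rewrite -sumrB.
rewrite exchange_big /=; under eq_bigr do rewrite block_laplacian.
rewrite -big_mkcond /= /curvature.
have -> : \sum_(i | x \in c i) (2%:R / (size (c i))%:R - 2%:R *+ (lab i v == x)) =
   \sum_(i | x \in c i) (2%:R / (size (c i))%:R - 2%:R) +
   \sum_(i | x \in c i) 2%:R *+ (lab i v != x) :> R.
  rewrite -big_split; apply: eq_bigr => i _ /=.
  by case: eqP => _; rewrite /= ?mulr1n ?mulr0n; ring.
rewrite [2%:R + _]addrC -addrA; congr (_ + _).
have [<- | xv] := eqVneq x v.
  rewrite big1 => [|i xi]; first by rewrite mulr1n subrr.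
  by rewrite (lab_id G xi) eqxx mulr0n.
have [i xi iP] := separating_block xv.
rewrite (bigD1 i) //= iP // eqxx big1 => [|j /andP[xj ji]].
  by rewrite [in RHS]mulr0n subr0 addr0 mulr1n.
by rewrite iP // (negbTE ji) mulr0n.
Qed.

Lemma cactus_resistanceE u v : resistance R e u v = rr u v.
Proof.
(* The curvatures cancel in the difference, and halving turns the two terms [2 [x = v]] and [2
   [x = u]] into a unit flow. *)
pose phi : {ffun T -> R^o} := [ffun x => (rr x v - rr x u) / 2%:R].
rewrite (@resistance_potential R T e cactus_simple (cactus_connected G) phi).
  rewrite !ffunE !cactus_resistance0 subr0 sub0r (cactus_resistanceC v u).
  by rewrite mulNr opprK -splitr.
apply/ffunP=> x; rewrite [LHS]ffunE [RHS]ffunE.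
have -> : \sum_(y | e x y) (phi x - phi y) =
  (\sum_(y | e x y) (rr x v - rr y v) - \sum_(y | e x y) (rr x u - rr y u)) / 2%:R.
  rewrite -sumrB mulr_suml; apply: eq_bigr => y _.
  by rewrite !ffunE -mulrBl; congr (_ / _); ring.
rewrite !laplacian_cactus_resistance.
case: (x == u); case: (x == v); rewrite ?mulr1n ?mulr0n; lra.
Qed.

End Resistance.
End Cactus.

(** * The degree resistance distance of a cactus *)

(** The factor is that of [block_weight]; a bridge thus has transmission 1. *)
Definition block_transmission (R : realFieldType) (k : nat) : R :=
  (if k == 2 then 2%:R else 1) * cycle_transmission R k.

(** The three summands come from the three parts of the degree in [degree_curvature]: the constant
    2, the curvature, and the terms of the cycles through the vertex. *)
Definition cactus_bound (R : realFieldType) (n : nat) (I : finType)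
    (k : I -> nat) : R :=
  \sum_i let t := block_transmission R (k i) in
    (2%:R * ((k i)%:R * t + 2%:R * (n%:R - (k i)%:R) * t)
     - n%:R * (2%:R / (k i)%:R * t)
     + \sum_(j | (2 < k j)%N) if j == i then n%:R * (2%:R / (k i)%:R * t)
                              else 2%:R * t).

Section DegreeResistance.
Context (R : realFieldType) (T I : finType).
Context (e : rel T) (c : I -> seq T) (lab : I -> T -> T).
Hypothesis G : cactus e c lab.
Implicit Types (x y v : T) (i j : I).

Let Uc i : uniq (c i) := block_uniq G i.
Let kc i : (1 < size (c i))%N := block_size G i.
Local Notation r := (block_resistance c lab R).
Local Notation rr := (cactus_resistance c lab R).
Local Notation t i := (block_transmission R (size (c i))).

Lemma size_block_neq0 i : (size (c i))%:R != 0 :> R.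
Proof. by rewrite pnatr_eq0 -lt0n ltnW. Qed.

Lemma sum_block_resistance i v : \sum_(x in c i) r i x v = t i.
Proof.
rewrite -big_uniq //= (big_nth v) big_mkord /block_transmission.
have jk : (index (lab i v) (c i) < size (c i))%N by rewrite index_mem (lab_mem G).
rewrite -(cycle_transmissionE R jk) mulr_sumr.
apply: eq_bigr => m _; rewrite /block_resistance /block_weight.
by rewrite (lab_id G) ?mem_nth // index_uniq.
Qed.

(** Summation by parts: the square is [g x * (g x - g y) + g y * (g y - g x)], and both halves have
    the same sum since [e] is symmetric. *)
Lemma dirichlet_energy (g : T -> R) :
  \sum_x \sum_(y | e x y) (g x - g y) ^+ 2 =
  2%:R * \sum_x g x * \sum_(y | e x y) (g x - g y).
Proof.
rewrite mulr_natl mulr2n [X in _ = _ + X](_ : _ =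
  \sum_x \sum_(y | e x y) g y * (g y - g x)); last first.
  under eq_bigr do rewrite mulr_sumr big_mkcond /=.
  rewrite exchange_big /=; apply: eq_bigr => x _; rewrite [RHS]big_mkcond /=.
  by apply: eq_bigr => y _; rewrite (cactus_sym G).
rewrite -big_split; apply: eq_bigr => x _ /=.
rewrite mulr_sumr -big_split; apply: eq_bigr => y _ /=; ring.
Qed.

(* As [curvature] is, away from [v], the Laplacian of [rr _ v], the sum is a
   Dirichlet energy, which splits over the blocks because each edge lies in
   exactly one of them. *)
Lemma sum_curvature v :
  \sum_x curvature c R x * rr x v = \sum_i 2%:R / (size (c i))%:R * t i.
Proof.
have -> : \sum_x curvature c R x * rr x v =
    \sum_x rr x v * \sum_(y | e x y) (rr x v - rr y v).
  apply: eq_bigr => x _; rewrite (laplacian_cactus_resistance G) mulrC mulrBr.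
  have [-> | _] := eqVneq x v; last by rewrite mulr0n mulr0 subr0.
  by rewrite cactus_resistance0 !mul0r subr0.
have energy g h : \sum_x \sum_(y | e x y) (g x - g y) ^+ 2 = h ->
    \sum_x g x * \sum_(y | e x y) (g x - g y) = h / 2%:R :> R.
  by rewrite dirichlet_energy => <-; rewrite mulrC mulKf // pnatr_eq0.
rewrite (energy _ (\sum_i \sum_x \sum_(y | e x y) (r i x v - r i y v) ^+ 2)).
  rewrite mulr_suml; apply: eq_bigr => i _.
  rewrite -(energy (r i ^~ v) _ erefl) -(sum_block_resistance i v) mulr_sumr.
  rewrite [RHS]big_mkcond /=; apply: eq_bigr => x _.
  rewrite (block_laplacian G); case: ifP => [xc | _]; last by rewrite mulr0.
  (* Where [v] projects to [x], the correction [- 2] is multiplied by [r i x v = 0]. *)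
  have [lx | _] := eqVneq; last by rewrite mulr0n subr0 mulrC.
  by rewrite block_resistance0 ?mul0r ?mulr0 // (lab_id G).
rewrite exchange_big /=; apply: eq_bigr => x _.
rewrite exchange_big /=; apply: eq_bigr => y exy.
rewrite -sumrB; have [i iP] := edge_block G exy.
have r0 j : j != i -> r j x v - r j y v = 0.
  rewrite -iP negbK => /eqP lxy.
  by rewrite (eq_block_resistance _ _ _ lxy) subrr.
rewrite (bigD1 i) //= [in LHS]big1 => [|j /r0 //]; rewrite addr0.
by rewrite (bigD1 i) //= big1 ?addr0 // => j /r0->; rewrite expr0n.
Qed.

(* The inner sum is the indicator of [x \in c i], in a form in which the sums
   over [x] and [y] can be exchanged. *)
Lemma degree_curvature x :
  (degree e x)%:R = 2%:R - curvature c R x +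
    \sum_(i | (2 < size (c i))%N) \sum_(y in c i | y == x) 2%:R / (size (c i))%:R.
Proof.
have -> : (degree e x)%:R = \sum_i \sum_(y | neighbours (c i) x y) 1 :> R.
  rewrite /degree -sum1_card natr_sum [RHS](exchange_big_dep xpredT) //=.
  rewrite big_mkcond [RHS]big_mkcond; apply: eq_bigr => y _.
  rewrite inE; case: ifP => [exy | nexy].
    have [i iP] := edge_block G exy; rewrite (big_pred1 i) ?mulr1n // => j.
    by rewrite /= -(block_edgeE G) exy iP.
  by rewrite big_pred0 // => i; rewrite -(block_edgeE G) nexy.
rewrite /curvature opprD addrA subrr add0r -sumrN.
rewrite [X in X + _]big_mkcond [X in _ + X]big_mkcond -big_split.
apply: eq_bigr => i _ /=; case: ifP => [xc | xc]; last first.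
  rewrite add0r big1 => [|y]; last by rewrite /neighbours xc.
  case: ifP => // _; rewrite big_pred0 // => y.
  by apply/andP=> -[yc /eqP yx]; rewrite -yx yc in xc.
have := big_neighbours (fun=> 1 : R) (Uc i) (kc i) xc.
(* A bridge gives [2 - 2 / 2 = 1] and has no cycle term; a longer cycle of length [k] gives
   [2 - 2 / k + 2 / k = 2]. *)
case: eqP => [-> Sn | /eqP k2].
  have -> : \sum_(y | neighbours (c i) x y) 1 = 1 :> R by lra.
  by rewrite /= divff ?pnatr_eq0 //; lra.
rewrite mul1r ltn_neqAle kc eq_sym k2 => -> /=.
rewrite (big_pred1 x) => [|y /=]; first by lra.
by case: eqP => [->|]; rewrite ?xc ?andbF.
Qed.

(** Exchanging [x] and [y] in the half with [d y] yields the pairs in the opposite order, and the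
    diagonal is zero. *)
Lemma sum_pairs (d : T -> nat) (f : T -> T -> R) :
  (forall x y, f x y = f y x) -> (forall x, f x x = 0) ->
  \sum_x \sum_(y | (enum_rank x < enum_rank y)%N) (d x + d y)%:R * f x y =
  \sum_x \sum_y (d x)%:R * f x y.
Proof.
move=> fC f0.
under eq_bigr => x _ do under eq_bigr => y _ do rewrite natrD mulrDl.
under eq_bigr => x _ do rewrite big_split.
rewrite big_split /= [X in _ + X](exchange_big_dep xpredT) //= -big_split.
apply: eq_bigr => x _ /=; rewrite [RHS](bigID (fun y => (enum_rank x < enum_rank y)%N)) /=.
congr (_ + _); rewrite big_mkcond [RHS]big_mkcond; apply: eq_bigr => y _ /=.
rewrite fC; case: ltngtP => // /val_inj/enum_rank_inj->.
by rewrite f0 mulr0.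
Qed.

(** The part of the contribution of block [i] that depends on how the rest is attached. The first
    sum stems from the constant 2 in the degree, the second from the terms of the other cycles. *)
Definition block_excess i : R :=
  2%:R * \sum_(x | x \notin c i) \sum_(v | v \notin c i) r i x v +
  \sum_(j | (2 < size (c j))%N && (j != i))
    \sum_(x in c j) 2%:R / (size (c j))%:R * \sum_(v | v \notin c i) r i x v.

Lemma sum_block_resistance_all i x :
  \sum_v r i x v = t i + \sum_(v | v \notin c i) r i x v.
Proof.
rewrite (bigID (mem (c i))) /=; congr (_ + _).
under eq_bigr do rewrite block_resistanceC.
exact: sum_block_resistance.
Qed.

(** Pairs are split by membership in block [i]: a vertex inside or outside sees total resistance
    [t i] to the block, so only pairs with both vertices outside remain. *)
Lemma kirchhoff_block i :
  \sum_x \sum_v r i x v =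
    (size (c i))%:R * t i + 2%:R * (#|T|%:R - (size (c i))%:R) * t i +
    \sum_(x | x \notin c i) \sum_(v | v \notin c i) r i x v.
Proof.
have in_out : \sum_(x in c i) \sum_(v | v \notin c i) r i x v =
    (#|T|%:R - (size (c i))%:R) * t i.
  rewrite exchange_big /=; under eq_bigr do rewrite sum_block_resistance.
  rewrite sumr_const -[LHS]mulr_natl.
  congr (_ * _); rewrite -(cardC (mem (c i))) (card_uniqP (Uc i)) natrD addrC.
  by rewrite addKr.
under eq_bigr do rewrite sum_block_resistance_all.
rewrite big_split /= sumr_const [X in _ + X](bigID (mem (c i))) /= in_out.
rewrite addrA -[X in X + _ + _]mulr_natl; congr (_ + _); ring.
Qed.

Lemma degree_resistance_distance_cactus :
  degree_resistance_distance R e =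
    cactus_bound R #|T| (fun i => size (c i)) + \sum_i block_excess i.
Proof.
rewrite /degree_resistance_distance sum_pairs; first last.
- by move=> x; rewrite (cactus_resistanceE G) cactus_resistance0.
- by move=> x y; rewrite resistanceC.
rewrite exchange_big /=.
(* The degree is replaced by [degree_curvature], and its curvature term is summed by
   [sum_curvature]. *)
have -> : \sum_v \sum_x (degree e x)%:R * resistance R e x v =
  \sum_v (2%:R * (\sum_x rr x v) - \sum_i 2%:R / (size (c i))%:R * t i +
   \sum_(j | (2 < size (c j))%N)
      \sum_(x in c j) 2%:R / (size (c j))%:R * rr x v).
  apply: eq_bigr => v _; rewrite -(sum_curvature v) mulr_sumr -sumrB.
  rewrite [X in _ + X](_ : _ = \sum_x (\sum_(i | (2 < size (c i))%N)
     \sum_(y in c i | y == x) 2%:R / (size (c i))%:R) * rr x v); last first.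
    under [RHS]eq_bigr do rewrite mulr_suml.
    rewrite exchange_big /=; apply: eq_bigr => j _.
    rewrite big_mkcond; apply: eq_bigr => x _ /=.
    case: ifP => xc; first rewrite (big_pred1 x) // => y /=.
      by case: eqP => [->|]; rewrite ?xc ?andbF.
    rewrite big_pred0 ?mul0r // => y.
    by apply/andP=> -[yc /eqP yx]; rewrite -yx yc in xc.
  rewrite -big_split; apply: eq_bigr => x _ /=.
  by rewrite degree_curvature (cactus_resistanceE G) mulrDl mulrBl.
rewrite big_split /= sumrB -mulr_sumr sumr_const -[X in _ - X + _]mulr_natl.
have -> : \sum_v \sum_x rr x v = \sum_i \sum_x \sum_v r i x v.
  rewrite exchange_big [RHS]exchange_big /=; apply: eq_bigr => x _.
  by rewrite exchange_big.
have -> : \sum_v \sum_(j | (2 < size (c j))%N)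
      \sum_(x in c j) 2%:R / (size (c j))%:R * rr x v =
    \sum_i \sum_(j | (2 < size (c j))%N)
      \sum_(x in c j) 2%:R / (size (c j))%:R * \sum_v r i x v.
  rewrite exchange_big [RHS]exchange_big /=; apply: eq_bigr => j _.
  rewrite exchange_big [RHS]exchange_big /=; apply: eq_bigr => x _.
  by rewrite -!mulr_sumr; congr (_ * _); rewrite exchange_big.
rewrite !mulr_sumr -sumrB -!big_split /=; apply: eq_bigr => i _.
rewrite kirchhoff_block /block_excess /=.
(* For [j = i] each of the [#|T|] vertices [v] contributes [t i]; for another cycle the weights
   [2 / size (c j)] add up to 2. *)
have -> : \sum_(j | (2 < size (c j))%N)
      \sum_(x in c j) 2%:R / (size (c j))%:R * \sum_v r i x v =
    \sum_(j | (2 < size (c j))%N)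
      (if j == i then #|T|%:R * (2%:R / (size (c i))%:R * t i) else 2%:R * t i) +
    \sum_(j | (2 < size (c j))%N && (j != i)) \sum_(x in c j)
      2%:R / (size (c j))%:R * \sum_(v | v \notin c i) r i x v.
  rewrite [X in _ + X]big_mkcondr -big_split; apply: eq_bigr => j _ /=.
  have [-> | ji] := eqVneq j i.
    rewrite addr0 -mulr_sumr exchange_big /=.
    under eq_bigr do rewrite sum_block_resistance.
    by rewrite sumr_const -[X in _ * X]mulr_natl mulrCA.
  under eq_bigr do rewrite sum_block_resistance_all mulrDr.
  rewrite big_split; congr (_ + _).
  rewrite sumr_const (card_uniqP (Uc j)) -[LHS]mulr_natl.
  by have := size_block_neq0 j => k0; field.
by ring.
Qed.

Lemma block_excess_ge0 i : 0 <= block_excess i.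
Proof.
rewrite addr_ge0 ?mulr_ge0 ?ler0n // !sumr_ge0 // => [x _|j _].
  by rewrite sumr_ge0 // => v _; apply: (block_resistance_ge0 G).
rewrite sumr_ge0 // => x _; rewrite mulr_ge0 ?divr_ge0 ?ler0n //.
by rewrite sumr_ge0 // => v _; apply: (block_resistance_ge0 G).
Qed.

(** A sum of nonnegative terms vanishes only termwise, and [r i x v] is zero only for equal
    projections. *)
Lemma block_excess_eq0 i : block_excess i = 0 <->
  (forall x v, x \notin c i -> v \notin c i -> lab i x = lab i v) /\
  (forall j x v, (2 < size (c j))%N -> j != i -> x \in c j -> v \notin c i ->
     lab i x = lab i v).
Proof.
have r_ge0 x v := block_resistance_ge0 G R i x v.
have r_eq0 x v : r i x v = 0 -> lab i x = lab i v.
  by apply: contra_eq => /(block_resistance_gt0 G R)/gt_eqF->.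
split=> [/eqP | [out1 out2]]; last first.
  rewrite /block_excess !big1 ?mulr0 ?addr0 // => [j /andP[kj ji]|x xi].
    rewrite big1 // => x xj; rewrite big1 ?mulr0 // => v vi.
    by rewrite block_resistance0 //; exact: (out2 j).
  by rewrite big1 // => v vi; rewrite block_resistance0 //; apply: out1.
have sum_ge0 (P Q : pred T) a : 0 <= a ->
    0 <= \sum_(x | P x) a * \sum_(v | Q v) r i x v.
  by move=> a0; rewrite sumr_ge0 // => x _; rewrite mulr_ge0 ?sumr_ge0.
have w_ge0 j : 0 <= 2%:R / (size (c j))%:R :> R by rewrite divr_ge0 ?ler0n.
rewrite /block_excess mulr_sumr paddr_eq0 ?sum_ge0 ?ler0n //; last first.
  by rewrite sumr_ge0 // => j _; rewrite sum_ge0.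
have sum_eq0 (P Q : pred T) a : 0 < a ->
    \sum_(x | P x) a * (\sum_(v | Q v) r i x v) == 0 ->
    forall x v, P x -> Q v -> lab i x = lab i v.
  move=> a0; rewrite psumr_eq0 => [/allP all0 x v Px Qv|x _]; last first.
    by rewrite mulr_ge0 ?(ltW a0) ?sumr_ge0.
  have := all0 x (mem_index_enum _); rewrite Px mulf_eq0 (gt_eqF a0) /=.
  rewrite psumr_eq0 // => /allP/(_ v (mem_index_enum _)).
  by rewrite Qv => /eqP/r_eq0.
case/andP=> out1 out2; split=> [|j x v kj ji xj vi].
  exact: sum_eq0 out1.
move: out2; rewrite psumr_eq0 => [/allP/(_ j (mem_index_enum _))|l _]; last first.
  exact: sum_ge0.
rewrite kj ji => /sum_eq0; apply=> //.
by rewrite divr_gt0 ?ltr0n // ltnW.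
Qed.

End DegreeResistance.

(** * Cacti whose blocks share a vertex *)

(* A cactus in which block [i] is [z :: s i] and two distinct blocks meet exactly
   in [z]. *)
Record bouquet (T I : finType) (e : rel T) (z : T) (s : I -> seq T) : Prop :=
  Bouquet {
    bouquet_uniq : forall i, uniq (z :: s i);
    bouquet_nonempty : forall i, (0 < size (s i))%N;
    bouquet_disjoint : forall i j x, x \in s i -> x \in s j -> i = j;
    bouquet_cover : forall x, x != z -> exists i, x \in s i;
    bouquet_edge : forall x y, e x y <-> exists i, neighbours (z :: s i) x y }.

Lemma neighbours_rot (T : eqType) m (c : seq T) :
  uniq c -> neighbours (rot m c) =2 neighbours c.
Proof. by move=> Uc x y; rewrite /neighbours !mem_rot !next_rot. Qed.

Section CactusBouquet.
Context (T I : finType) (e : rel T).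

(** With two cycles, each block has a cycle other than itself, and by hypothesis everything outside
    the block projects to where that cycle does. The common vertex [z] is the projection of the
    cycle [b] on [a]. *)
Lemma cactus_bouquet (c : I -> seq T) (lab : I -> T -> T) (a b : I) :
  cactus e c lab -> a != b -> (2 < size (c a))%N -> (2 < size (c b))%N ->
  (forall i j x v, (2 < size (c j))%N -> j != i -> x \in c j ->
     v \notin c i -> lab i x = lab i v) ->
  exists z s, bouquet e z s /\ forall i, size (c i) = (size (s i)).+1.
Proof.
move=> G ab ka kb labP; have Uc := block_uniq G.
have /hasP[y0 yb _] : has predT (c b) by rewrite has_predT (leq_trans _ kb).
pose z := lab a y0.
have za : z \in c a := lab_mem G a y0.
have other i : exists2 j, (2 < size (c j))%N & j != i.
  by have [<-|] := eqVneq a i; [exists b; rewrite // eq_sym | exists a].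
(* If block [i] missed [z], some block [j] through [z] would separate [z] from its projection [w] on
   [i]. Then all of block [i] projects on [j] to a vertex other than [z], whereas the hypothesis
   makes each vertex outside [j] project to [z]. *)
have zc i : z \in c i.
  apply/negPn/negP=> zi; have ai : a != i by apply: contraNneq zi => <-.
  pose w := lab i z; have wi : w \in c i := lab_mem G i z.
  have wz : z != w by apply: contraNneq zi => ->.
  have [j zj jP] := separating_block G wz.
  have {jP} lwz : lab j w != z by rewrite jP.
  have ji : j != i by apply: contraNneq zi => <-.
  (* Block [i] has a single projection on [j], so [w] and its successor cannot both lie on [j]. *)
  have [u ui uj] : exists2 u, u \in c i & u \notin c j.
    have wn : next (c i) w \in c i by rewrite mem_next.
    have := next_neq (Uc i) (block_size G i) wi.
    have [wj | ] := boolP (w \in c j); last by exists w.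
    have [nj | ] := boolP (next (c i) w \in c j); last by exists (next (c i) w).
    by rewrite -[X in X != _](lab_id G nj) (lab_const G ji wn wi) (lab_id G wj) eqxx.
  have lu : lab j u = lab j w := lab_const G ji ui wi.
  case/eqP: lwz; rewrite -lu.
  have [aj | aj] := eqVneq a j.
    have bj : b != j by rewrite -aj eq_sym.
    by rewrite -(labP j b y0 u kb bj yb uj) -aj.
  by rewrite -(labP j a z u ka aj za uj) (lab_id G zj).
have [rotc] : exists f : I -> nat * seq T,
    forall i, rot (f i).1 (c i) = z :: (f i).2.
  apply: (@fin_all_exists I (fun=> (nat * seq T)%type)
    (fun i f => rot f.1 (c i) = z :: f.2)) => i.
  have [m s' def_c] := rot_to (zc i).
  by exists (m, s').
set s := fun i => (rotc i).2 => def_c.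
have mem_s i x : (x \in c i) = (x \in z :: s i).
  by rewrite -def_c mem_rot.
have Uzs i : uniq (z :: s i) by rewrite -def_c rot_uniq.
have size_s i : size (c i) = (size (s i)).+1.
  by rewrite -(size_rot (rotc i).1) def_c.
exists z, s; split=> //; split=> // [i|i j x xi xj|x xz|x y].
- by have := block_size G i; rewrite size_s ltnS.
- apply/eqP; apply: contraT => ij; have xz : x != z.
    by apply: contraTneq xi => ->; have /andP[] := Uzs i.
  have xci : x \in c i by rewrite mem_s inE xi orbT.
  have xcj : x \in c j by rewrite mem_s inE xj orbT.
  by rewrite -(lab_id G xci) (lab_const G ij xcj (zc j)) (lab_id G) ?eqxx in xz.
- rewrite eq_sym in xz; have [i _ iP] := separating_block G xz.
  have := iP i (zc i); rewrite eqxx => lxz; exists i.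
  (* Outside block [i], the vertex [x] would project to [z], since [z] lies on another cycle. *)
  have [|xi] := boolP (x \in c i); first by rewrite mem_s inE eq_sym (negbTE xz).
  have [j kj ji] := other i.
  by rewrite -(labP i j z x kj ji (zc j) xi) (lab_id G) ?eqxx in lxz.
- split=> [exy | [i]]; last first.
    by rewrite -def_c neighbours_rot // => /(neighbours_edge G).
  have [i iP] := edge_block G exy; exists i.
  by rewrite -def_c neighbours_rot // -(block_edgeE G) exy iP eqxx.
Qed.

(** All blocks hang at [z], so a vertex outside a block projects to [z]. The graph is connected
    because each block is a closed walk through [z]. *)
Lemma bouquet_cactus z (s : I -> seq T) : bouquet e z s -> I ->
  cactus e (fun i => z :: s i) (fun i x => if x \in s i then x else z).
Proof.
move=> B i0; have Uzs := bouquet_uniq B.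
have zs i : z \in s i = false by apply/negbTE; have /andP[] := Uzs i.
have lab_out i j x : i != j -> x \in z :: s j -> x \in s i = false.
  move=> ij; rewrite inE => /orP[/eqP-> // | xj]; apply/negbTE.
  by apply: contra ij => xi; rewrite (bouquet_disjoint B xi xj).
have e_sym : symmetric e.
  move=> x y; apply/idP/idP=> /(bouquet_edge B)[i nxy].
    by apply/(bouquet_edge B); exists i; rewrite neighbours_sym.
  by apply/(bouquet_edge B); exists i; rewrite neighbours_sym.
have edge_blk x y : e x y -> exists2 i, neighbours (z :: s i) x y &
    forall j, ((if x \in s j then x else z) != (if y \in s j then y else z)) =
              (j == i).
  case/(bouquet_edge B)=> i nxy; exists i => // j; have [xi yi _] := and3P nxy.
  have [-> | ji] := eqVneq j i; last by rewrite !(lab_out j i) // eqxx.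
  have lab_id u : u \in z :: s i -> (if u \in s i then u else z) = u.
    by rewrite inE; case: ifP => // _ /orP[/eqP|].
  have ki : (1 < size (z :: s i))%N by rewrite ltnS (bouquet_nonempty B).
  by rewrite !lab_id // (neighbours_neq (Uzs i) ki nxy).
split=> //.
- have conn_z x : connect e z x.
    have [-> // | /(bouquet_cover B)[i xi]] := eqVneq x z.
    have : cycle e (z :: s i).
      apply: cycle_from_next => // y yi; apply/(bouquet_edge B); exists i.
      by rewrite /neighbours yi mem_next yi eqxx.
    move=> /= /path_connect; apply.
    by rewrite inE mem_rcons inE xi !orbT.
  move=> x y; apply: connect_trans (conn_z y).
  by rewrite (sym_connect_sym e_sym).
- by move=> i /=; rewrite ?ltnS (bouquet_nonempty B).
- by move=> i x; case: ifP => xi; rewrite inE ?xi ?eqxx ?orbT.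
- by move=> i x; rewrite inE; case: ifP => // _ /orP[/eqP|].
- move=> i x y /edge_blk[j nxy jP]; rewrite jP => /eqP ij.
  by rewrite ij.
- by move=> i x y nxy; apply/(bouquet_edge B); exists i.
- by move=> x y /edge_blk[i _ iP]; exists i.
Qed.

End CactusBouquet.

(** * Isomorphism of bouquets with equal block lengths *)

Section BouquetIsomorphism.
Context (I : finType).

(** Vertices correspond by their position along the block; in a bouquet the block picked is
    unique. *)
Definition bouquet_map (T T' : finType) (z : T) (s : I -> seq T)
    (z' : T') (s' : I -> seq T') (x : T) : T' :=
  if [pick i | x \in s i] is Some i then
    nth z' (z' :: s' i) (index x (z :: s i))
  else z'.

(** The choice of a block through [x] does not matter: only the centre lies in several, and it has
    position 0 in each. *)
Lemma bouquet_mapE (T T' : finType) (e : rel T) z (s : I -> seq T)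
    (z' : T') (s' : I -> seq T') i x :
  bouquet e z s -> x \in z :: s i ->
  bouquet_map z s z' s' x = nth z' (z' :: s' i) (index x (z :: s i)).
Proof.
move=> B; have Uzs := bouquet_uniq B; rewrite inE => /orP[/eqP-> | xi].
  rewrite /bouquet_map; case: pickP => [j zj | _]; last by rewrite /= eqxx.
  by have := Uzs j; rewrite /= zj.
rewrite /bouquet_map; case: pickP => [j xj | /(_ i)]; last by rewrite xi.
by rewrite (bouquet_disjoint B xj xi).
Qed.

Context (T T' : finType) (e : rel T) (e' : rel T').
Context (z : T) (s : I -> seq T) (z' : T') (s' : I -> seq T').
Hypotheses (B : bouquet e z s) (B' : bouquet e' z' s').
Hypothesis eq_size : forall i, size (s i) = size (s' i).

Let eq_block_size i : size (z' :: s' i) = size (z :: s i).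
Proof. by rewrite /= eq_size. Qed.

Lemma bouquet_block x : I -> exists i, x \in z :: s i.
Proof.
move=> i0; have [-> | /(bouquet_cover B)[i xi]] := eqVneq x z.
  by exists i0; rewrite mem_head.
by exists i; rewrite inE xi orbT.
Qed.

Lemma bouquet_map_mem i x : x \in z :: s i ->
  bouquet_map z s z' s' x \in z' :: s' i.
Proof.
move=> xi; rewrite (bouquet_mapE _ _ B xi) mem_nth //.
by rewrite eq_block_size index_mem.
Qed.

Lemma bouquet_map_index i x : x \in z :: s i ->
  index (bouquet_map z s z' s' x) (z' :: s' i) = index x (z :: s i).
Proof.
move=> xi; rewrite (bouquet_mapE _ _ B xi) index_uniq ?(bouquet_uniq B') //.
by rewrite eq_block_size index_mem.
Qed.

Lemma bouquet_mapK :
  I -> cancel (bouquet_map z s z' s') (bouquet_map z' s' z s).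
Proof.
move=> i0 x; have [i xi] := bouquet_block x i0.
rewrite (bouquet_mapE _ _ B' (bouquet_map_mem xi)) bouquet_map_index //.
exact: nth_index.
Qed.

Lemma bouquet_map_edge x y :
  e x y -> e' (bouquet_map z s z' s' x) (bouquet_map z s z' s' y).
Proof.
case/(bouquet_edge B)=> i /and3P[xi yi nxy]; apply/(bouquet_edge B'); exists i.
rewrite /neighbours !bouquet_map_mem //=.
have Uzs := bouquet_uniq B i; have Uzs' := bouquet_uniq B' i.
have map_next u v : u \in z :: s i -> v \in z :: s i ->
    v == next (z :: s i) u ->
    bouquet_map z s z' s' v == next (z' :: s' i) (bouquet_map z s z' s' u).
  move=> ui vi /eqP def_v; have fu := bouquet_map_mem ui.
  have fn : next (z' :: s' i) (bouquet_map z s z' s' u) \in z' :: s' i.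
    by rewrite mem_next.
  apply/eqP/(index_inj z' (bouquet_map_mem vi) fn).
  by rewrite index_next // !bouquet_map_index // def_v index_next // eq_block_size.
by apply/orP; case/orP: nxy => nxy; [left | right]; apply: map_next.
Qed.

End BouquetIsomorphism.

(** The construction with the two bouquets exchanged gives the inverse map, which preserves edges
    for the same reason. *)
Lemma bouquet_iso (I T T' : finType) (e : rel T) (e' : rel T')
    (z : T) (s : I -> seq T) (z' : T') (s' : I -> seq T') :
  bouquet e z s -> bouquet e' z' s' -> (forall i, size (s i) = size (s' i)) ->
  I -> graph_iso e e'.
Proof.
move=> B B' eq_size i0; have eq_size' i := esym (eq_size i).
have fK := bouquet_mapK B B' eq_size i0.
exists (bouquet_map z s z' s'); split=> [|x y].
  by exists (bouquet_map z' s' z s) => //; apply: bouquet_mapK B' B eq_size' i0.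
apply/idP/idP; last exact: bouquet_map_edge B B' eq_size _ _.
by move/(bouquet_map_edge B' B eq_size'); rewrite !fK.
Qed.

Lemma neighbours_map (T T' : eqType) (f : T -> T') (c : seq T) x y :
  injective f -> uniq c -> neighbours (map f c) (f x) (f y) = neighbours c x y.
Proof.
by move=> f_inj Uc; rewrite /neighbours !mem_map // !next_map // !(inj_eq f_inj).
Qed.

Lemma neighbours_pair (T : eqType) (a b x y : T) : a != b ->
  neighbours [:: a; b] x y = (x == a) && (y == b) || (x == b) && (y == a).
Proof.
move=> ab.
have na : next [:: a; b] a = b by rewrite /= eqxx.
have nb : next [:: a; b] b = a by rewrite /= eq_sym (negbTE ab) eqxx.
rewrite /neighbours !in_cons !in_nil !orbF.
apply/idP/idP=> [/and3P[/orP[]/eqP-> /orP[]/eqP->] | /orP[] /andP[/eqP-> /eqP->]].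
- by rewrite na (negbTE ab).
- by rewrite !eqxx.
- by rewrite !eqxx orbT.
- by rewrite nb eq_sym (negbTE ab).
- by rewrite na !eqxx orbT.
- by rewrite nb !eqxx orbT.
Qed.

(** [None] and [Some None] stand for the two cycles, [Some (Some j)] for the [b] bridges. *)
Definition block_length (p q b : nat) (i : option (option 'I_b)) : nat :=
  match i with None => p | Some None => q | Some (Some _) => 2 end.

(** * The extremal graph as a bouquet *)

Section StarGraph.
Context (m p q : nat).
Hypotheses (hp : (3 <= p)%N) (hq : (3 <= q)%N) (hn : (p + q - 1 <= m.+1)%N).
Local Notation b := (m.+1 + 1 - p - q)%N.

Definition star_block (i : option (option 'I_b)) : seq nat :=
  match i with
  | None => iota 1 p.-1
  | Some None => iota p q.-1
  | Some (Some j) => [:: (p + q - 1 + j)%N]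
  end.

Lemma star_block_range i x : x \in star_block i -> (0 < x < m.+1)%N.
Proof.
case: i => [[j|]|] /=; rewrite ?inE ?mem_iota; last by lia.
  by have := ltn_ord j => jb /eqP->; lia.
lia.
Qed.

Lemma star_block_disjoint i j x :
  x \in star_block i -> x \in star_block j -> i = j.
Proof.
case: i => [[i|]|]; case: j => [[j|]|] //=; rewrite ?inE ?mem_iota //;
  try by move=> h1 h2; exfalso; lia.
by move=> /eqP-> /eqP ij; congr (Some (Some _)); apply: val_inj => /=; lia.
Qed.

Lemma star_block_cover x : (0 < x < m.+1)%N -> exists i, x \in star_block i.
Proof.
move=> xm; have [xp | px] := ltnP x p.
  by exists None; rewrite mem_iota; lia.
have [xq | qx] := ltnP x (p + q - 1)%N.
  by exists (Some None); rewrite mem_iota; lia.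
have jb : (x - (p + q - 1) < b)%N by lia.
by exists (Some (Some (Ordinal jb))); rewrite inE /=; lia.
Qed.

Lemma star_block_uniq i : uniq (0%N :: star_block i).
Proof.
rewrite cons_uniq; apply/andP; split; first by apply/negP => /star_block_range.
by case: i => [[j|]|]; rewrite /star_block ?iota_uniq.
Qed.

Lemma size_star_block i : (size (star_block i)).+1 = block_length p q i.
Proof. by case: i => [[j|]|] //=; rewrite size_iota; lia. Qed.

Lemma star_bouquet :
  bouquet (S_graph m.+1 p q) ord0 (fun i => map inord (star_block i)).
Proof.
have val_s i : map val (ord0 :: map inord (star_block i) : seq 'I_m.+1) =
    0%N :: star_block i.
  rewrite /= -map_comp; congr (_ :: _); rewrite -[RHS]map_id.
  by apply/eq_in_map => x /star_block_range/andP[_ xm]; rewrite /= inordK.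
have mem_s i (x : 'I_m.+1) :
    (x \in (map inord (star_block i) : seq 'I_m.+1)) = (val x \in star_block i).
  have : (ord0 \in (map inord (star_block i) : seq 'I_m.+1)) = false.
    apply/mapP=> -[y /star_block_range/andP[y0 ym] /(congr1 val)].
    by rewrite /= inordK // => y0'; rewrite -y0' in y0.
  move=> z_out; have := mem_map val_inj (ord0 :: map inord (star_block i)) x.
  rewrite val_s !inE -(inj_eq val_inj) /=.
  have [x0|//] := eqVneq (val x) 0%N.
  have -> : x = ord0 by apply: val_inj.
  by rewrite z_out => _; apply/esym/negP => /star_block_range.
have Us i : uniq (ord0 :: map inord (star_block i) : seq 'I_m.+1).
  by rewrite -(map_inj_uniq val_inj) val_s star_block_uniq.
split=> [//|i|i j x|x x0|x y].
- by rewrite size_map -ltnS size_star_block; case: i => [[j|]|] /=; lia.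
- by rewrite !mem_s => /star_block_disjoint; apply.
- have [|i xi] := @star_block_cover x; last by exists i; rewrite mem_s.
  by rewrite ltn_ord lt0n andbT; apply: contra x0 => /eqP x0; apply/eqP/val_inj.
(* Adjacency is transported to natural numbers by the injection [val]. *)
- have nE i : neighbours (ord0 :: map inord (star_block i)) x y =
      cycle_adj (0%N :: star_block i) x y.
    by rewrite -(neighbours_map _ _ val_inj (Us i)) val_s.
  have iotaE : iota 0 p = 0%N :: star_block None by rewrite /=; case: p hp.
  have pairE (u v : nat) j : cycle_adj (0%N :: star_block (Some (Some j))) u v =
      (u == 0%N) && (v == (p + q - 1 + j)%N) ||
      (u == (p + q - 1 + j)%N) && (v == 0%N).
    by rewrite -neighbours_pair //; lia.
  rewrite /S_graph iotaE; split.
    case/or4P=> [h|h|/andP[x0 py]|/andP[y0 px]].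
    + by exists None; rewrite nE.
    + by exists (Some None); rewrite nE.
    + have jb : (y - (p + q - 1) < b)%N by have := ltn_ord y; lia.
      exists (Some (Some (Ordinal jb))); rewrite nE pairE x0 /=.
      by rewrite subnKC // eqxx.
    + have jb : (x - (p + q - 1) < b)%N by have := ltn_ord x; lia.
      exists (Some (Some (Ordinal jb))); rewrite nE pairE y0 /=.
      by rewrite subnKC // eqxx orbT.
  case=> [[[j|]|]]; rewrite nE; [|by move->; rewrite orbT|by move->].
  rewrite pairE /pendent_adj => /orP[] /andP[/eqP-> /eqP->].
    by rewrite leq_addr !orbT.
  by rewrite leq_addr !orbT.
Qed.

End StarGraph.

(** * Graphs with exactly two cycles *)

Section EdgeSets.
Context (T : finType).
Implicit Types (F P C : {set {set T}}) (A X : {set T}) (c : seq T).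
Implicit Types (f : {set T}) (x y : T).

(** Subgraphs are given by their edge sets, so that deleting and counting edges are set
    operations. *)
Definition adjacent F : rel T := fun x y => [set x; y] \in F.

Lemma adjacent_sym F : symmetric (adjacent F).
Proof. by move=> x y; rewrite /adjacent setUC. Qed.

Lemma adjacent_connect_sym F : connect_sym (adjacent F).
Proof. exact/sym_connect_sym/adjacent_sym. Qed.

Lemma connect_adjacentS F P x y : F \subset P ->
  connect (adjacent F) x y -> connect (adjacent P) x y.
Proof.
move=> FP; apply: connect_sub => {x y} x y xy; apply: connect1.
exact: (subsetP FP).
Qed.

Lemma eq_set2 (x y a b : T) : [set x; y] = [set a; b] ->
  (x = a /\ y = b) \/ (x = b /\ y = a).
Proof.
move=> eq_xy.
have /set2P xab : x \in [set a; b] by rewrite -eq_xy set21.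
have /set2P yab : y \in [set a; b] by rewrite -eq_xy set22.
have /set2P axy : a \in [set x; y] by rewrite eq_xy set21.
have /set2P bxy : b \in [set x; y] by rewrite eq_xy set22.
by intuition congruence.
Qed.

Lemma mem_edges (e : rel T) x y : symmetric e -> ([set x; y] \in edges e) = e x y.
Proof.
move=> e_sym; apply/imsetP/idP=> [[[a b]] | exy]; last first.
  by exists (x, y); rewrite ?inE.
by rewrite inE /= => eab /eq_set2[] [-> ->] //; rewrite e_sym.
Qed.

Lemma connect_exit (r : rel T) A a y : connect r a y -> a \in A -> y \notin A ->
  exists u v, [/\ r u v, u \in A & v \notin A].
Proof.
case/connectP=> s; elim: s a => [|b s IHs] a /= => [_ -> ->|] //.
case/andP=> rab rs def_y aA yA; have [bA | bA] := boolP (b \in A).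
  exact: IHs rs def_y bA yA.
by exists a, b.
Qed.

(* [P] is a forest with exactly one tree for each root in [A]. *)
Lemma spanning_forest F A :
  (forall x, exists2 a, a \in A & connect (adjacent F) a x) ->
  exists P, [/\ P \subset F, (#|P| + #|A|)%N = #|T| &
    forall x, exists2 a, a \in A & connect (adjacent P) a x].
Proof.
move=> F_span.
(* [X] collects the vertices reached so far. An edge leaving [X] adds one vertex and one edge, which
   preserves the count. *)
suff grow k X P : A \subset X -> P \subset F -> (forall f, f \in P -> f \subset X) ->
    (#|P| + #|A|)%N = #|X| ->
    (forall x, x \in X -> exists2 a, a \in A & connect (adjacent P) a x) ->
    #|~: X| = k ->
    exists P', [/\ P' \subset F, (#|P'| + #|A|)%N = #|T| &
      forall x, exists2 a, a \in A & connect (adjacent P') a x].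
  apply: (grow _ A set0) => //; rewrite ?sub0set ?cards0 //.
  - by move=> f; rewrite inE.
  - by move=> x xA; exists x.
elim: k X P => [|k IHk] X P AX PF PX cardP P_span cardX.
  have XT : X = [set: T] by rewrite -[X]setCK (cards0_eq cardX) setC0.
  by exists P; split=> // [|x]; [rewrite cardP XT cardsT | apply: P_span; rewrite XT inE].
have [y] : exists y, y \in ~: X by apply/set0Pn; rewrite -card_gt0 cardX.
rewrite inE => yX; have [a aA ay] := F_span y.
have [u [v [uv uX vX]]] := connect_exit ay (subsetP AX a aA) yX.
have uvP : [set u; v] \notin P.
  by apply: contra vX => /PX/subsetP; apply; rewrite set22.
have P_sub : P \subset [set u; v] |: P := subsetUr _ _.
apply: (IHk (v |: X) ([set u; v] |: P)).
- exact: subset_trans AX (subsetUr _ _).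
- by rewrite subUset sub1set PF andbT.
- move=> f /setU1P[-> | /PX fX]; last exact: subset_trans fX (subsetUr _ _).
  by rewrite subUset !sub1set !inE uX eqxx orbT.
- by rewrite !cardsU1 uvP vX -cardP.
- move=> x /setU1P[-> | /P_span[a' a'A a'x]]; last first.
    by exists a' => //; apply: connect_adjacentS a'x.
  have [a' a'A a'u] := P_span u uX; exists a' => //.
  apply: connect_trans (connect_adjacentS P_sub a'u) (connect1 _).
  by rewrite /adjacent setU11.
- rewrite setCU -setDE setDE setIC -setDE.
  by have := cardsD1 v (~: X); rewrite inE vX cardX => -[].
Qed.

Lemma adjacent_cycle_edges c x y : uniq c ->
  adjacent (cycle_edges c) x y = neighbours c x y.
Proof.
move=> Uc; apply/imsetP/and3P=> [[z zc /eq_set2[[-> ->]|[-> ->]]] | [xc yc]].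
- by rewrite mem_next zc eqxx.
- by rewrite mem_next zc eqxx orbT.
- case/orP=> /eqP->; first by exists x.
  by exists y => //; rewrite setUC.
Qed.

(** If two positions gave the same edge with its ends swapped, the successor and the predecessor of
    [x] would coincide. *)
Lemma cycle_edge_inj c : uniq c -> (2 < size c)%N ->
  {in c &, injective (fun x => [set x; next c x])}.
Proof.
move=> Uc kc x y xc yc /eq_set2[[//]|[xy yx]].
have := next_prev_neq Uc kc xc.
by rewrite {2}xy prev_next // yx eqxx.
Qed.

Lemma card_cycle_edges c : uniq c -> (2 < size c)%N ->
  #|cycle_edges c| = size c.
Proof.
move=> Uc kc; rewrite card_in_imset; first exact/card_uniqP.
exact: cycle_edge_inj.
Qed.

Lemma cycle_edges_rot m c : uniq c -> cycle_edges (rot m c) = cycle_edges c.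
Proof.
move=> Uc; apply/setP=> f; apply/imsetP/imsetP=> -[x xc ->]; exists x;
  by rewrite ?next_rot // ?mem_rot // -(mem_rot m).
Qed.

(** Rotated so that [f] joins the last vertex to the first, the cycle without [f] is a path through
    all its vertices. *)
Lemma connect_cycle_edgesD1 c f x y : uniq c -> (2 < size c)%N ->
  f \in cycle_edges c -> x \in c -> y \in c ->
  connect (adjacent (cycle_edges c :\ f)) x y.
Proof.
move=> Uc kc /imsetP[w wc ->] xc yc.
have nc : next c w \in c by rewrite mem_next.
have [m s def_c] := rot_to nc.
rewrite -(cycle_edges_rot m Uc) -(next_rot m Uc).
have [Us ks] : uniq (rot m c) /\ (2 < size (rot m c))%N.
  by rewrite rot_uniq size_rot.
have : w \in rot m c by rewrite mem_rot.
have : x \in rot m c by rewrite mem_rot.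
have : y \in rot m c by rewrite mem_rot.
have : prev (rot m c) (next c w) = w by rewrite -(next_rot m Uc) prev_next.
move: Us ks; rewrite def_c; set a := next c w => Us ks wP yc' xc' wc'.
set F := _ :\ _.
suff aF : path (adjacent F) a s.
  have conn := path_connect aF.
  by apply: connect_trans (conn y yc'); rewrite adjacent_connect_sym conn.
apply/(pathP a) => i ik.
have uc : nth a (a :: s) i \in a :: s by rewrite mem_nth //= ltnW.
have nu : nth a s i = next (a :: s) (nth a (a :: s) i).
  by rewrite next_nth uc index_uniq //= ltnW.
rewrite nu /adjacent /F in_setD1; apply/andP; split; last exact: imset_f.
(* Otherwise [i] would be the position of [w], the last vertex, which is [size s]. *)
apply/eqP=> /(cycle_edge_inj Us ks uc wc') /(congr1 (index^~ (a :: s))).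
rewrite -[in RHS]wP index_prev ?mem_head // index_uniq //= ?eqxx; last exact: ltnW.
by move=> si; rewrite si ltnn in ik.
Qed.

(** Wherever a walk uses [f], the rest of the cycle provides a detour. *)
Lemma connect_adjacentD1 F c f x y : uniq c -> (2 < size c)%N ->
  cycle_edges c \subset F -> f \in cycle_edges c ->
  connect (adjacent F) x y -> connect (adjacent (F :\ f)) x y.
Proof.
move=> Uc kc cF fc; apply: connect_sub => {x y} x y xy.
have [def_f | nf] := eqVneq [set x; y] f; last first.
  by apply: connect1; rewrite /adjacent in_setD1 nf.
have : neighbours c x y by rewrite -adjacent_cycle_edges // /adjacent def_f.
case/and3P=> xc yc _; apply: connect_adjacentS (setSD _ cF) _.
exact: connect_cycle_edgesD1.
Qed.

(** A simple path from [a] to [b] that avoids the edge is closed by that edge. *)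
Lemma cycle_through_edge F (a b : T) : a != b -> [set a; b] \in F ->
  connect (adjacent (F :\ [set a; b])) a b ->
  exists c, [/\ uniq c, (2 < size c)%N, cycle_edges c \subset F &
               [set a; b] \in cycle_edges c].
Proof.
move=> ab abF /connectP[p0]; case/shortenP=> p ps Us _ def_b.
(* A path of one step would be the deleted edge itself, so the cycle has at least three vertices. *)
have kp : (1 < size p)%N.
  case: p ps Us def_b => [|b' [|b'' p]] //=; first by move=> _ _ ba; rewrite ba eqxx in ab.
  by rewrite andbT => ab' _ def_b; rewrite /adjacent def_b setD11 in ab'.
have c_cycle : cycle (adjacent F) (a :: p).
  rewrite /= rcons_path -def_b adjacent_sym {2}/adjacent abF andbT.
  by apply: sub_path ps => x y; rewrite /adjacent in_setD1 => /andP[].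
have bp : b \in a :: p by rewrite def_b mem_last.
exists (a :: p); split=> //.
  by apply/subsetP=> f /imsetP[x xc ->]; apply: (next_cycle c_cycle).
apply/imsetP; exists b => //; rewrite setUC; congr [set _; _].
by rewrite next_nth bp def_b index_last // nth_default.
Qed.

Lemma connect_edges (e : rel T) x y : symmetric e -> connected_graph e ->
  connect (adjacent (edges e)) x y.
Proof.
move=> e_sym e_conn; apply: connect_sub (e_conn x y) => {x y} x y exy.
by apply: connect1; rewrite /adjacent mem_edges.
Qed.

(** Along a path from a vertex of [c], the starting point is reset whenever an edge of [c] is used,
    since such an edge ends on [c]. *)
Lemma reach_block F c x : (forall x y, connect (adjacent F) x y) ->
  uniq c -> (0 < size c)%N ->
  exists2 a, a \in c & connect (adjacent (F :\: cycle_edges c)) a x.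
Proof.
move=> F_conn Uc kc; have [a ac] : exists a, a \in c.
  by case: (c) kc => // a s; exists a; rewrite mem_head.
have /connectP[s] := F_conn a x.
have : exists2 b, b \in c & connect (adjacent (F :\: cycle_edges c)) b a.
  by exists a.
elim: s a {ac} => [|y s IHs] a [b bc ba] /= => [_ ->|]; first by exists b.
case/andP=> ay; apply: IHs.
have [nay | nay] := boolP (neighbours c a y).
  by have [_ yc _] := and3P nay; exists y.
exists b => //; apply: connect_trans ba (connect1 _).
rewrite /adjacent in_setD -[_ \in cycle_edges _]/(adjacent _ a y).
by rewrite adjacent_cycle_edges // nay.
Qed.

(** Once the edges of block [i] are deleted, each vertex stays joined to some vertex of the block by
    [reach_block], and to only one by the last hypothesis; this vertex is its projection. *)
Lemma cactus_of_blocks (I : finType) (e : rel T) (Bl : I -> {set {set T}})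
    (len : I -> nat) :
  simple_graph e -> connected_graph e ->
  (forall f, f \in edges e -> exists i, forall j, (f \in Bl j) = (j == i)) ->
  (forall i, exists c, [/\ uniq c, (1 < size c)%N /\ size c = len i,
     Bl i = cycle_edges c, Bl i \subset edges e &
     forall x y, x \in c -> y \in c ->
       connect (adjacent (edges e :\: Bl i)) x y -> x = y]) ->
  exists (c : I -> seq T) (lab : I -> T -> T),
    cactus e c lab /\ forall i, size (c i) = len i.
Proof.
move=> [e_sym e_irr] e_conn e_part /fin_all_exists[c cP].
have Uc i : uniq (c i) by have [] := cP i.
have nE i x y : neighbours (c i) x y = ([set x; y] \in Bl i).
  by have [_ _ -> _ _] := cP i; rewrite -adjacent_cycle_edges.
have nout i x y : e x y -> ~~ neighbours (c i) x y ->
    connect (adjacent (edges e :\: Bl i)) x y.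
  by move=> exy; rewrite nE => nB; apply: connect1; rewrite /adjacent inE nB mem_edges.
have reach i x : exists2 a, a \in c i & connect (adjacent (edges e :\: Bl i)) a x.
  have [_ [k1 _] -> _ _] := cP i; apply: reach_block; rewrite ?(ltnW k1) //.
  by move=> *; apply: connect_edges.
have /fin_all_exists[lab labP] i : exists l : {ffun T -> T}, forall x,
    l x \in c i /\ connect (adjacent (edges e :\: Bl i)) (l x) x.
  have /fin_all_exists[l lP] x : exists a, a \in c i /\
      connect (adjacent (edges e :\: Bl i)) a x.
    by have [a] := reach i x; exists a.
  by exists (finfun l) => x; rewrite ffunE.
have labL i x : lab i x \in c i by case: (labP i x).
have lab_eq i x y : y \in c i ->
    connect (adjacent (edges e :\: Bl i)) y x -> lab i x = y.
  move=> yc yx; have [_ _ _ _ sep] := cP i; apply: sep => //.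
  have [_ lx] := labP i x; apply: connect_trans lx _.
  by rewrite adjacent_connect_sym.
have lab_id i x : x \in c i -> lab i x = x by move=> xc; apply: lab_eq.
have e_lab i x y : e x y -> lab i x != lab i y -> neighbours (c i) x y.
  move=> exy; apply: contraNT => nxy; apply/eqP/esym/lab_eq => //.
  by have [_ lx] := labP i x; apply: connect_trans lx (nout _ _ _ exy nxy).
have n_e i x y : neighbours (c i) x y -> e x y.
  rewrite nE -(mem_edges x y e_sym); have [_ _ _ sub _] := cP i.
  exact: (subsetP sub).
exists c, (fun i => lab i); split=> [|i]; last by have [_ []] := cP i.
split=> // [i|x y exy]; first by have [_ []] := cP i.
have [|i iP] := e_part [set x; y]; first by rewrite mem_edges.
exists i => j; rewrite -iP -nE; apply/idP/idP=> [|nxy]; first exact: e_lab.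
have [xc yc _] := and3P nxy; rewrite !lab_id //.
by apply: contraTneq (n_e _ _ _ nxy) => ->; rewrite e_irr.
Qed.

End EdgeSets.

(** * Disjointness of the two cycles and the cactus structure *)

Section TwoCycles.
Context (T : finType) (e : rel T) (C1 C2 : {set {set T}}).
Hypotheses (e_simple : simple_graph e) (e_conn : connected_graph e).
Hypothesis card_e : #|edges e| = #|T|.+1.
Hypothesis two_cycles : forall C, is_cycle e C <-> C = C1 \/ C = C2.
Local Notation E := (edges e).

Lemma is_cycleE C : is_cycle e C <->
  exists c, [/\ uniq c, (2 < size c)%N, C = cycle_edges c & C \subset E].
Proof.
have [e_sym _] := e_simple; split=> -[c].
  case=> /andP[c_cycle Uc] kc ->; exists c; split=> //.
  apply/subsetP=> f /imsetP[x xc ->]; rewrite mem_edges //.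
  exact: next_cycle c_cycle xc.
case=> Uc kc -> cE; exists c; split=> //; rewrite /ucycle Uc andbT.
apply: cycle_from_next => // x xc; rewrite -mem_edges //.
by apply: (subsetP cE); apply: imset_f.
Qed.

Lemma nonbridge_in_cycle (a b : T) (F : {set {set T}}) : F \subset E -> [set a; b] \in F ->
  connect (adjacent (F :\ [set a; b])) a b ->
  exists2 C, C = C1 \/ C = C2 & C \subset F /\ [set a; b] \in C.
Proof.
have [e_sym e_irr] := e_simple => FE abF ab_conn.
have ab : a != b.
  apply: contraTneq (subsetP FE _ abF) => <-.
  by rewrite mem_edges // e_irr.
have [c [Uc kc cF abc]] := cycle_through_edge ab abF ab_conn.
exists (cycle_edges c) => //; apply/two_cycles/is_cycleE; exists c; split=> //.
exact: subset_trans cF FE.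
Qed.

(* If [f] were a common edge, [E :\ f] would be connected with one edge more than
   a spanning tree, hence contain a cycle that avoids [f]. *)
Lemma cycles_disjoint : [disjoint C1 & C2].
Proof.
have [e_sym e_irr] := e_simple.
have /is_cycleE[c [Uc kc def_C1 C1E]] : is_cycle e C1 by apply/two_cycles; left.
rewrite -setI_eq0; apply/set0Pn=> -[f /setIP[fC1 fC2]].
have [r0 _] : exists r0, r0 \in c by case: (c) kc => // a s; exists a; rewrite mem_head.
have [|P [PF cardP P_span]] := @spanning_forest T (E :\ f) [set r0].
  move=> x; exists r0; rewrite ?inE //.
  apply: connect_adjacentD1 Uc kc _ _ (connect_edges _ _ e_sym e_conn); rewrite -def_C1 //.
have P_conn x y : connect (adjacent P) x y.
  have [_ /set1P-> rx] := P_span x; have [_ /set1P-> ry] := P_span y.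
  by apply: connect_trans ry; rewrite adjacent_connect_sym.
have fE : f \in E := subsetP C1E f fC1.
have /subsetPn[g gF gP] : ~~ (E :\ f \subset P).
  apply/negP=> /subset_leq_card.
  by move: cardP card_e; rewrite (cardsD1 f E) fE cards1; lia.
have /imsetP[[a b] /=] := subsetP (subD1set _ _) g gF.
rewrite inE /= => eab def_g; rewrite def_g in gF gP.
(* The tree [P] joins [a] and [b] without their edge, so that edge lies on a cycle within [E :\ f];
   yet both cycles contain [f]. *)
have [|C C_C12 [CF _]] := nonbridge_in_cycle (subD1set _ _) gF.
  apply: connect_adjacentS (P_conn a b); rewrite subsetD1 PF.
  by rewrite gP.
have : f \notin C by apply/negP=> /(subsetP CF); rewrite setD11.
by case: C_C12 => ->; rewrite ?fC1 ?fC2.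
Qed.

Lemma bridge_separates (a b : T) : [set a; b] \in E :\: C1 :\: C2 ->
  ~~ connect (adjacent (E :\ [set a; b])) a b.
Proof.
rewrite 2!in_setD => /and3P[abC2 abC1 abE]; apply/negP=> ab_conn.
have [C C_C12 [_ abC]] := nonbridge_in_cycle (subxx _) abE ab_conn.
by case: C_C12 abC => ->; rewrite ?(negbTE abC1) ?(negbTE abC2).
Qed.

End TwoCycles.

(* Otherwise [E :\: C1] minus one edge of [C2] would still connect everything to
   the vertices of [C1] other than [x], and it has one edge too few for that. *)
Lemma cycle_separates (T : finType) (e : rel T) (C1 C2 : {set {set T}}) c x y :
  simple_graph e -> connected_graph e -> #|edges e| = #|T|.+1 ->
  (forall C, is_cycle e C <-> C = C1 \/ C = C2) ->
  uniq c -> (2 < size c)%N -> C1 = cycle_edges c -> x \in c -> y \in c ->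
  connect (adjacent (edges e :\: C1)) x y -> x = y.
Proof.
move=> e_simple e_conn card_e two_cycles Uc kc def_C1 xc yc xy_conn.
have dis := cycles_disjoint e_simple e_conn card_e two_cycles.
have /(is_cycleE e_simple)[_ [_ _ _ C1E]] : is_cycle e C1 by apply/two_cycles; left.
have /(is_cycleE e_simple)[c2 [Uc2 kc2 def_C2 C2E]] : is_cycle e C2.
  by apply/two_cycles; right.
apply/eqP/negPn/negP=> xy; pose A := [set z in c] :\ x.
have [f fC2] : exists f, f \in C2.
  by rewrite def_C2; case: (c2) kc2 => // a s; exists [set a; next (a :: s) a];
     apply: imset_f; rewrite mem_head.
have C2H : C2 \subset edges e :\: C1 by rewrite subsetD C2E disjoint_sym.
pose H := (edges e :\: C1) :\ f.
have [t|P [PH cardP _]] := @spanning_forest T H A.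
  have [e_sym _] := e_simple.
  have E_conn u v := connect_edges u v e_sym e_conn.
  have [a ac] := reach_block t E_conn Uc (ltnW (ltnW kc)).
  rewrite -def_C1 => at_conn.
  have toH u v : connect (adjacent (edges e :\: C1)) u v ->
      connect (adjacent H) u v.
    by apply: connect_adjacentD1 Uc2 kc2 _ _; rewrite -def_C2.
  (* A vertex attached at [x] is reached from [y] through the assumed connection outside [C1]. *)
  have [ax | ax] := eqVneq a x; last by exists a; rewrite ?inE ?ax //; apply: toH.
  exists y; first by rewrite !inE eq_sym xy.
  apply: toH; apply: connect_trans at_conn.
  by rewrite ax adjacent_connect_sym.
have := subset_leq_card PH.
have cardA : (size c = #|A|.+1)%N.
  by have := cardsD1 x [set z in c]; rewrite inE xc cardsE (card_uniqP Uc).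
have cardH : (#|edges e :\: C1| = #|H|.+1)%N.
  by rewrite (cardsD1 f) (subsetP C2H _ fC2).
have cardE : (#|edges e| = size c + #|edges e :\: C1|)%N.
  by rewrite -(cardsID C1) (setIidPr C1E) {1}def_C1 card_cycle_edges.
by move: cardP card_e; clear -cardA cardH cardE; lia.
Qed.

(** As the two cycles are edge-disjoint, [m.+1 + 1 - p - q] further edges remain; each is a bridge
    and forms a block of its own. *)
Lemma bicyclic_cactus (p q m : nat) (T : finType) (e : rel T) :
  bicyclic_class m.+1 p q e ->
  exists (c : option (option 'I_(m.+1 + 1 - p - q)) -> seq T) lab,
    cactus e c lab /\ forall i, size (c i) = block_length p q i.
Proof.
case=> card_T [e_simple e_conn card_e] [C1 [C2 [C12 card_C1 card_C2 two_cycles]]].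
have two_cycles' C : is_cycle e C <-> C = C2 \/ C = C1.
  by rewrite two_cycles; split=> -[]; auto.
have [e_sym e_irr] := e_simple.
have dis := cycles_disjoint e_simple e_conn card_e two_cycles.
have /(is_cycleE e_simple)[c1 [Uc1 kc1 def_C1 C1E]] : is_cycle e C1.
  by apply/two_cycles; left.
have /(is_cycleE e_simple)[c2 [Uc2 kc2 def_C2 C2E]] : is_cycle e C2.
  by apply/two_cycles; right.
pose D := edges e :\: C1 :\: C2.
have cardD : (m.+1 + 1 - p - q)%N = #|D|.
  have C2D : C2 \subset edges e :\: C1 by rewrite subsetD C2E disjoint_sym.
  have := cardsID C1 (edges e); have := cardsID C2 (edges e :\: C1).
  rewrite -/D (setIidPr C1E) (setIidPr C2D) card_C1 card_C2 card_e card_T; lia.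
pose Bl (i : option (option 'I_(m.+1 + 1 - p - q))) : {set {set T}} :=
  match i with
  | None => C1
  | Some None => C2
  | Some (Some j) => [set enum_val (cast_ord cardD j)]
  end.
have memD (j : 'I_(m.+1 + 1 - p - q)) : enum_val (cast_ord cardD j) \in D.
  exact: enum_valP.
apply: (cactus_of_blocks (Bl := Bl)) => // [f fE | [[j|]|]].
- have [fC1 | fC1] := boolP (f \in C1).
    exists None => -[[j|]|] /=; last exact: fC1.
      by apply/set1P=> fj; have := memD j; rewrite -fj !inE fC1 andbF.
    by apply: (disjointFr dis fC1).
  have [fC2 | fC2] := boolP (f \in C2).
    exists (Some None) => -[[j|]|] /=; rewrite ?fC2 //; last exact: negbTE.
    by apply/set1P=> fj; have := memD j; rewrite -fj !inE fC2.
  have fD : f \in D by rewrite !in_setD fC1 fC2.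
  have [j0 def_f] : exists j0, f = enum_val (cast_ord cardD j0).
    exists (cast_ord (esym cardD) (enum_rank_in fD f)).
    by rewrite cast_ordKV enum_rankK_in.
  exists (Some (Some j0)) => -[[j|]|] /=; rewrite ?(negbTE fC1) ?(negbTE fC2) //.
  rewrite in_set1 def_f; apply/eqP/eqP=> [ | [->]] //.
  by move/enum_val_inj/cast_ord_inj->.
- have /imsetP[[a b]] : enum_val (cast_ord cardD j) \in edges e.
    by have := memD j; rewrite !inE => /and3P[].
  rewrite inE /= => eab def_f.
  have abD : [set a; b] \in D by rewrite -def_f.
  have ab : a != b by apply: contraTneq eab => ->; rewrite e_irr.
  have sep := bridge_separates e_simple two_cycles abD.
  exists [:: a; b]; split=> //=.
  + by rewrite inE ab.
  + rewrite def_f; apply/setP=> f; rewrite in_set1.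
    have na : next [:: a; b] a = b by rewrite /= eqxx.
    have nb : next [:: a; b] b = a by rewrite /= eq_sym (negbTE ab) eqxx.
    apply/eqP/imsetP=> [-> | [x]]; first by exists a; rewrite ?inE ?eqxx ?na.
    by rewrite !inE => /orP[]/eqP-> ->; rewrite ?na ?nb // setUC.
  + by rewrite sub1set; have := memD j; rewrite !inE => /and3P[].
  + rewrite def_f => x y; rewrite !inE => /orP[]/eqP-> /orP[]/eqP-> //.
      by rewrite (negbTE sep).
    by rewrite adjacent_connect_sym (negbTE sep).
- exists c2; split=> //=.
  + by split; [apply: ltnW | rewrite -card_cycle_edges // -def_C2].
  + by move=> x y; apply: (cycle_separates e_simple e_conn card_e two_cycles').
- exists c1; split=> //=.
  + by split; [apply: ltnW | rewrite -card_cycle_edges // -def_C1].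
  + by move=> x y; apply: (cycle_separates e_simple e_conn card_e two_cycles).
Qed.

(** * Comparison with the extremal graph *)

Lemma eq_cactus_bound (R : realFieldType) (n : nat) (I : finType)
    (k k' : I -> nat) : k =1 k' -> cactus_bound R n k = cactus_bound R n k'.
Proof.
move=> eq_k; apply: eq_bigr => i _ /=; rewrite eq_k; congr (_ + _).
by apply: eq_bigl => j; rewrite eq_k.
Qed.

Theorem theorem3p1 (R : realFieldType) (n p q : nat)
    (hp : (3 <= p)%N) (hq : (3 <= q)%N) (hn : (p + q - 1 <= n)%N)
    (T : finType) (e : rel T)
    (hG : bicyclic_class n p q e)
    (hne : ~ graph_iso e (S_graph n p q)) :
  degree_resistance_distance R (S_graph n p q) <
  degree_resistance_distance R e.
Proof.
case: n hn hG hne => [|m] hn hG hne; first by exfalso; lia.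
have [c [lab [G size_c]]] := bicyclic_cactus hG.
have BS := star_bouquet hp hq hn.
have GS := bouquet_cactus BS None.
rewrite (degree_resistance_distance_cactus R G).
rewrite (degree_resistance_distance_cactus R GS).
rewrite card_ord; case: (hG) => -> _ _.
rewrite [X in X + _ < _](eq_cactus_bound R m.+1 (k' := fun i => size (c i)));
  last first.
  by move=> i; rewrite size_c -(size_star_block hp hq hn) /= size_map.
(* In the extremal graph everything outside a block, and every other block, projects to the common
   vertex, so all excesses vanish. *)
rewrite ltrD2l [ltLHS]big1 => [|i _]; last first.
  apply/(block_excess_eq0 R GS); split=> [x v|j x v _ ji].
    by rewrite !inE !negb_or => /andP[_ /negbTE->] /andP[_ /negbTE->].
  rewrite !inE negb_or => xj /andP[_ /negbTE->]; case: ifP => // xi.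
  case/orP: xj => [/eqP // | xj].
  by rewrite (bouquet_disjoint BS xi xj) eqxx in ji.
rewrite lt_neqAle sumr_ge0 ?andbT => [|i _]; last exact: (block_excess_ge0 R G).
rewrite eq_sym psumr_eq0 => [|i _]; last exact: (block_excess_ge0 R G).
(* If all excesses of the given graph vanish, it is a bouquet with the same block lengths, hence
   isomorphic to the extremal graph. *)
apply/negP=> /allP all0; apply: hne.
have [|||i j x v kj ji xj vi|z [s [B size_s]]] :=
  @cactus_bouquet _ _ e c lab None (Some None) G; rewrite ?size_c //.
  have /eqP/(block_excess_eq0 R G)[_ out] := all0 i (mem_index_enum _).
  exact: out kj ji xj vi.
apply: (bouquet_iso B BS _ None) => i; apply: succn_inj.
by rewrite -size_s size_c size_map size_star_block.
Qed.
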